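(* Let $X,Y$ be Banach spaces, $D\subset X$ a convex open set, and $T:D\to Y$ a continuously Fréchet differentiable operator. Let $x^*\in D$ satisfy $T(x^* )=0$ and $[T'(x^* )]^{-1}\in L(Y,X)$. Let $\psi_0,\psi:[0,+\infty)\to[0,+\infty)$ be continuous non-decreasing functions with $\psi_0(0)=\psi(0)=0$, and let $\rho_0$, the functions $\eta_1,\eta_2,\eta_3,\eta_4$ and the radius $\rho$ be defined from $\psi_0,\psi$ as in the context (under the assumptions on $H_1,\dots,H_4$ stated there). Suppose that $$\|[T'(x^* )]^{-1}(T'(x)-T'(x^* ))\|\le\psi_0(\|x-x^*\|)\quad\text{for each }x\in D,$$ $$\|[T'(x^* )]^{-1}(T'(x)-T'(y))\|\le\psi(\|x-y\|)\quad\text{for each }x,y\in D_0:=D\cap B(x^*,\rho_0),$$ and $B(x^*,\rho)\subseteq D$. Then for every $x_0\in B(x^*,\rho)\setminus\{x^*\}$ the sequence $\{x_n\}$ generated by $$\begin{aligned} y_n&=x_n-\tfrac12[T'(x_n)]^{-1}T(x_n),\\ z_n^{(1)}&=x_n-[T'(y_n)]^{-1}T(x_n),\\ z_n^{(2)}&=z_n^{(1)}-\big(2[T'(y_n)]^{-1}-[T'(x_n)]^{-1}\big)T(z_n^{(1)}),\\ x_{n+1}&=z_n^{(2)}-\big(2[T'(y_n)]^{-1}-[T'(x_n)]^{-1}\big)T(z_n^{(2)}) \end{aligned}$$ is well defined, remains in $B(x^*,\rho)$ for each $n=0,1,2,\dots$, and converges to $x^*$. Moreover, for each $n\ge 0$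 the following estimates hold: $$\|y_n-x^*\|\le\eta_1(\|x_n-x^*\|)\|x_n-x^*\|\le\|x_n-x^*\|<\rho,$$ $$\|z_n^{(1)}-x^*\|\le\eta_2(\|x_n-x^*\|)\|x_n-x^*\|\le\|x_n-x^*\|<\rho,$$ $$\|z_n^{(2)}-x^*\|\le\eta_3(\|x_n-x^*\|)\|x_n-x^*\|\le\|x_n-x^*\|<\rho,$$ $$\|x_{n+1}-x^*\|\le\eta_4(\|x_n-x^*\|)\|x_n-x^*\|\le\|x_n-x^*\|<\rho.$$ Furthermore, if there exists $\varrho\ge\rho$ such that $\int_0^1\psi_0(\theta\varrho)\,d\theta<1$, then $x^*$ is the only solution of $T(x)=0$ in $D_1:=D\cap\overline{B(x^*,\varrho)}$.
   Context: $L(Y,X)$ is the space of bounded linear operators from $Y$ to $X$. $B(x^*,r)$ and $\overline{B(x^*,r)}$ are the open and closed balls in $X$ with center $x^*$ and radius $r$. $T'$ is the Fréchet derivative of $T$. Given continuous non-decreasing $\psi_0,\psi:[0,+\infty)\to[0,+\infty)$ with $\psi_0(0)=\psi(0)=0$, put $\rho_0=\sup\{t\ge0:\psi_0(t)<1\}$. On $[0,\rho_0)$ (wherever the denominators do not vanish) define $$\eta_1(a)=\frac{1}{1-\psi_0(a)}\left[\frac12\int_0^1(\psi_0(ta)+1)\,dt+\int_0^1\psi((1-t)a)\,dt\right],\qquad p(a)=\psi_0(\eta_1(a)a),$$ $$\eta_2(a)=\frac{1}{1-\psi_0(a)}\left[\int_0^1\psi((1-t)a)\,dt+\frac{\big(\psi(\eta_1(a)a)+\psi(a)\big)\int_0^1(\psi_0(ta)+1)\,dt}{1-p(a)}\right],$$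 and, for $i=3,4$, $$\begin{aligned}\eta_i(a)=\Bigg[&\frac{\int_0^1\psi((1-t)\eta_{i-1}(a)a)\,dt}{1-\psi_0(\eta_{i-1}(a)a)}+\frac{\psi(\eta_1(a)a)+\psi(\eta_{i-1}(a)a)}{1-\psi_0(\eta_{i-1}(a)a)}\cdot\frac{\int_0^1(\psi_0(t\eta_{i-1}(a)a)+1)\,dt}{1-p(a)}\\&+\frac{\psi(\eta_1(a)a)+\psi(a)}{1-\psi_0(a)}\cdot\frac{\int_0^1(\psi_0(t\eta_{i-1}(a)a)+1)\,dt}{1-p(a)}\Bigg]\eta_{i-1}(a).\end{aligned}$$ Let $H_i(a)=\eta_i(a)-1$ for $i=1,2,3,4$, and $\overline{\rho}_0=\sup\{a\in[0,\rho_0):\psi_0(\eta_1(a)a)<1\}$. Standing assumption: $H_1(a)$ and $H_2(a)$ each tend to $+\infty$ or to a positive constant as $a\to\rho_0^-$, and $H_3(a)$ and $H_4(a)$ each tend to $+\infty$ or to a positive constant as $a\to\overline{\rho}_0^-$; the functions $H_i$ then have zeros in $(0,\rho_0)$. Let $\rho_i$ denote the smallest zero of $H_i$ in $(0,\rho_0)$, and define $\rho=\min\{\rho_1,\rho_2,\rho_3,\rho_4\}$. *)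

(* Defs.v *)
From HB Require Import structures.
From mathcomp Require Import all_boot all_order all_algebra.
From mathcomp Require Import all_classical all_reals all_analysis.

Set Implicit Arguments.
Unset Strict Implicit.
Unset Printing Implicit Defensive.

Import Order.TTheory GRing.Theory Num.Theory.
Import numFieldNormedType.Exports.

Local Open Scope classical_set_scope.
Local Open Scope ring_scope.

Section Operators.
Context {R : realType} {X Y : normedModType R}.

(* Extended-real valued, so that no junk value arises for unbounded maps. *)
Definition opnorm (V W : normedModType R) (A : V -> W) : \bar R :=
  ereal_sup [set `|A x|%:E | x in [set x : V | `|x| <= 1]].

(* The two-sided inverse of [A] when [A] is bijective. *)
Definition opinv (A : X -> Y) : Y -> X := 'pinv_(fun=> 0) [set: X] A.

(* For a linear map [A]: the inverse of [A] exists and belongs to L(Y, X). *)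
Definition has_bounded_inverse (A : X -> Y) : Prop :=
  bijective A /\ continuous (opinv A).

(* [T] is continuously Frechet differentiable on the open set [D]; the
   derivative is continuous for the operator norm. *)
Definition continuously_differentiable_on (D : set X) (T : X -> Y) : Prop :=
  forall x, D x ->
    differentiable T x /\ opnorm ('d T y \- 'd T x) @[y --> x] --> 0%E.

(* Center [c] and a radius that may be [+oo]. *)
Definition eball (c : X) (r : \bar R) : set X := [set x | (`|c - x|%:E < r)%E].

End Operators.

Section Iteration.
Context {R : realType} {X Y : normedModType R}.
Variable T : X -> Y.

Definition iter_y (x : X) : X := x - 2^-1 *: opinv ('d T x) (T x).

Definition iter_z1 (x : X) : X := x - opinv ('d T (iter_y x)) (T x).

Definition correction (x z : X) : X :=
  z - (2 *: opinv ('d T (iter_y x)) (T z) - opinv ('d T x) (T z)).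

Definition iter_z2 (x : X) : X := correction x (iter_z1 x).

Definition iter_next (x : X) : X := correction x (iter_z2 x).

Definition iter_seq (x0 : X) (n : nat) : X := iter n iter_next x0.

End Iteration.

Section Majorants.
Context {R : realType}.

(* Functions from [0, +oo[ to itself are represented by functions on [R] whose
   values at negative arguments are irrelevant. *)
Definition majorant (psi : R -> R) : Prop :=
  [/\ {within `[0, +oo[, continuous psi},
      {in `[0, +oo[ &, {homo psi : s t / s <= t}},
      forall t, 0 <= t -> 0 <= psi t
    & psi 0 = 0].

Definition int01 (f : R -> R) : R := \int[lebesgue_measure]_(t in `[0, 1]) f t.

Variables psi0 psi : R -> R.

Definition rho0 : \bar R :=
  ereal_sup (EFin @` [set t | 0 <= t /\ psi0 t < 1]).

Definition eta1 (a : R) : R :=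
  (1 - psi0 a)^-1 * (2^-1 * int01 (fun t => psi0 (t * a) + 1)
                     + int01 (fun t => psi ((1 - t) * a))).

Definition p (a : R) : R := psi0 (eta1 a * a).

Definition eta2 (a : R) : R :=
  (1 - psi0 a)^-1 *
    (int01 (fun t => psi ((1 - t) * a))
     + (psi (eta1 a * a) + psi a) * int01 (fun t => psi0 (t * a) + 1)
       / (1 - p a)).

(* [eta_i a] for [i = 3, 4], where [e] stands for [eta_(i-1) a]. *)
Definition eta_step (e a : R) : R :=
  (int01 (fun t => psi ((1 - t) * e * a)) / (1 - psi0 (e * a))
   + (psi (eta1 a * a) + psi (e * a)) / (1 - psi0 (e * a))
     * (int01 (fun t => psi0 (t * e * a) + 1) / (1 - p a))
   + (psi (eta1 a * a) + psi a) / (1 - psi0 a)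
     * (int01 (fun t => psi0 (t * e * a) + 1) / (1 - p a))) * e.

Definition eta3 (a : R) : R := eta_step (eta2 a) a.

Definition eta4 (a : R) : R := eta_step (eta3 a) a.

(* Points at which the formula for [eta_i] is meaningful: the denominators do
   not vanish and [psi0], [psi] are evaluated at nonnegative arguments.  They
   keep the convention [x / 0 = 0] from creating spurious zeros or limits. *)
Definition dom1 (a : R) : Prop := 0 <= a /\ psi0 a != 1.

Definition dom2 (a : R) : Prop :=
  [/\ dom1 a, 0 <= eta1 a * a & p a != 1].

Definition dom3 (a : R) : Prop :=
  [/\ dom2 a, 0 <= eta2 a * a & psi0 (eta2 a * a) != 1].

Definition dom4 (a : R) : Prop :=
  [/\ dom3 a, 0 <= eta3 a * a & psi0 (eta3 a * a) != 1].

Definition H1 (a : R) : R := eta1 a - 1.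
Definition H2 (a : R) : R := eta2 a - 1.
Definition H3 (a : R) : R := eta3 a - 1.
Definition H4 (a : R) : R := eta4 a - 1.

Definition rho0bar : \bar R :=
  ereal_sup (EFin @` [set a | [/\ 0 <= a, (a%:E < rho0)%E
                                & psi0 (eta1 a * a) < 1]]).

(* The filter "[a] tends to [r] from below", for [0 <= r <= +oo]. *)
Definition from_below (r : \bar R) : set_system R :=
  if r is s%:E then s^'- else +oo.

(* [H], meaningful on [dom], tends to [+oo] or to a positive constant as its
   argument tends to [r] from below. *)
Definition tends_to_positive (dom : R -> Prop) (H : R -> R) (r : \bar R)
    : Prop :=
  (\forall a \near from_below r, dom a) /\
  (H @ from_below r --> +oo \/
   exists2 c : R, 0 < c & H @ from_below r --> c).

(* [r] is the smallest zero in (0, rho0) of [H], meaningful on [dom]. *)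
Definition smallest_zero (dom : R -> Prop) (H : R -> R) (r : R) : Prop :=
  let zeros := [set a : R | [/\ 0 < a, (a%:E < rho0)%E, dom a & H a = 0]] in
  zeros r /\ lbound zeros r.

End Majorants.

(* Main.v *)
(* Write B for the inverse of T'(x^* ).  The center condition makes B T'(x) a
   perturbation of the identity of size psi0 |x - x^*| < 1, so T'(x) is
   invertible and |T'(x)^-1 w| <= |B w| / (1 - psi0 |x - x^*|).  Thus every
   estimate reduces to bounding preconditioned residuals B w, which the mean
   value inequality does along the segment from x^*; comparing with a scalar
   primitive there avoids vector-valued integrals.  Each substep is a Newton
   step plus differences of inverses
   L^-1 - M^-1 = L^-1 (M - L) M^-1, and this yields the eta_i.

   The eta_i are nonnegative, nondecreasing and continuous, and by the
   intermediate value theorem they stay below 1 up to their first zero of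
   eta_i - 1.  Monotonicity of eta_4 then gives geometric convergence. *)
Require Import Defs.
From HB Require Import structures.
From mathcomp Require Import all_boot all_order all_algebra.
From mathcomp Require Import all_classical all_reals all_analysis.
From mathcomp Require Import ring lra.

Import Order.TTheory GRing.Theory Num.Theory.
Import numFieldNormedType.Exports.

Local Open Scope classical_set_scope.
Local Open Scope ring_scope.

(** * Majorants and the radius *)

Section Gauge.
Context {R : realType}.
Implicit Types (I : interval R) (f g psi : R -> R).

(** The three properties are bundled because sums, products, compositions and [1 / (1 - f)] for
    [f < 1] preserve them together; every [eta_i] is assembled from these operations. Continuity is
    taken within [I], since values of a majorant at negative arguments carry no information. *)
Definition gauge I f : Prop :=
  [/\ {in I, forall x, 0 <= f x},
      {in I &, {homo f : x y / x <= y}}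
    & {within [set` I], continuous f}].

Lemma gauge_cst I (k : R) : 0 <= k -> gauge I (fun=> k).
Proof. by move=> k0; split => // x; exact: cst_continuous. Qed.

Lemma gauge_id (c : R) : gauge `[0, c] id.
Proof.
split=> [x|//|]; first by rewrite in_itv => /andP[].
by apply: continuous_subspaceT => x; exact: cvg_id.
Qed.

Lemma gaugeD I f g : gauge I f -> gauge I g -> gauge I (fun x => f x + g x).
Proof.
move=> [f0 fm fc] [g0 gm gc]; split=> [x xI|x y xI yI xy|].
- by rewrite addr_ge0 ?f0 ?g0.
- by rewrite lerD ?fm ?gm.
- by move=> x; apply: cvgD; [exact: fc|exact: gc].
Qed.

Lemma gaugeM I f g : gauge I f -> gauge I g -> gauge I (fun x => f x * g x).
Proof.
move=> [f0 fm fc] [g0 gm gc]; split=> [x xI|x y xI yI xy|].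
- by rewrite mulr_ge0 ?f0 ?g0.
- by rewrite ler_pM ?f0 ?g0 ?fm ?gm.
- by move=> x; apply: cvgM; [exact: fc|exact: gc].
Qed.

Lemma gauge_inv1B I f : {in I, forall x, f x < 1} -> gauge I f ->
  gauge I (fun x => (1 - f x)^-1).
Proof.
move=> f1 [f0 fm /subspace_continuousP fc]; split=> [x xI|x y xI yI xy|].
- by rewrite invr_ge0 subr_ge0 ltW ?f1.
- by rewrite lef_pV2 ?posrE ?subr_gt0 ?f1// lerD2l lerN2 fm.
- apply/subspace_continuousP => x xI; apply: cvgV.
    by rewrite subr_eq0 eq_sym lt_eqF ?f1.
  by apply: cvgB; [exact: cvg_cst|exact: fc].
Qed.

Lemma gauge_comp I psi f : gauge `[0, +oo[ psi -> gauge I f ->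
  gauge I (fun x => psi (f x)).
Proof.
move=> [p0 pm /subspace_continuousP pc] [f0 fm /subspace_continuousP fc].
have fI x : x \in I -> f x \in `[0, +oo[ by move=> /f0; rewrite in_itv /= andbT.
split=> [x xI|x y xI yI xy|].
- exact/p0/fI.
- by apply: pm; [exact: fI|exact: fI|exact: fm].
- apply/subspace_continuousP => x xI.
  apply: (cvg_comp f psi (G := within `[0, +oo[%classic (nbhs (f x)))).
    move=> A /= /(fc x xI)/= ; rewrite !nbhs_simpl /within /= => H.
    by apply: filterS H => z /= h zI; apply: h; rewrite // fI.
  by apply: pc; rewrite /= fI.
Qed.

Lemma majorant_gauge psi : majorant psi -> gauge `[0, +oo[ psi.
Proof.
by case=> pc pm p0 _; split=> // x; rewrite in_itv /= andbT => /p0.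
Qed.

(** Truncating the argument at 0 keeps [psi] on nonnegative arguments and gives a function
    continuous on the whole line, the form in which integrands are used below. *)
Lemma gauge_max0_continuous psi : gauge `[0, +oo[ psi ->
  continuous (fun t : R => psi (Num.max 0 t)).
Proof.
move=> [p0 pm /subspace_continuousP pc] x.
apply: (cvg_comp (Num.max 0) psi
          (G := within `[0, +oo[%classic (nbhs (Num.max 0 x)))).
  have mc : Num.max 0 @ x --> Num.max 0 x.
    by apply: continuous_max; [exact: cvg_cst|exact: cvg_id].
  move=> A /= /mc /=; rewrite !nbhs_simpl /within /= => H.
  by apply: filterS H => z /= h; apply: h; rewrite in_itv /= le_max lexx.
by apply: pc; rewrite /= in_itv /= le_max lexx.
Qed.

(** * Integrals over [0, 1] depending on a parameter *)

Lemma int01_ge0 f : {in `[0, 1], forall t, 0 <= f t} -> 0 <= int01 f.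
Proof. by move=> f0; apply: Rintegral_ge0 => x /= /f0. Qed.

Lemma eq_int01 f g : {in `[0, 1], f =1 g} -> int01 f = int01 g.
Proof. by move=> fg; apply: eq_Rintegral => x; rewrite inE; exact: fg. Qed.

Lemma continuous_integrable01 f : continuous f ->
  lebesgue_measure.-integrable `[0, 1] (EFin \o f).
Proof.
move=> cf; apply: continuous_compact_integrable; first exact: segment_compact.
exact: continuous_subspaceT.
Qed.

Lemma le_int01 f g : continuous f -> continuous g ->
  {in `[0, 1], forall t, f t <= g t} -> int01 f <= int01 g.
Proof.
move=> cf cg fg; apply: le_Rintegral => //=; exact: continuous_integrable01.
Qed.

(** Continuity passes under the integral by domination, monotonicity by comparison of integrands.
    The weight [k] stands for either [t] or [1 - t]. *)
Lemma gauge_int01 I psi (k : R -> R) f : gauge `[0, +oo[ psi -> continuous k ->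
  {in `[0, 1], forall t, 0 <= k t <= 1} -> gauge I f ->
  gauge I (fun x => int01 (fun t => psi (k t * f x))).
Proof.
move=> gpsi kc k01 gf.
have [p0 pm _] := gpsi; have [f0 fm _] := gf.
(* With the truncated integrand, the integral [J u] is continuous for every real [u]; the claim then
   follows by composing [J] with [f]. *)
pose psiE (t : R) := psi (Num.max 0 t).
have psiEc : continuous psiE := gauge_max0_continuous _ gpsi.
have psiEkc u : continuous (fun t : R => psiE (k t * u)).
  move=> t; apply: (cvg_comp (fun t => k t * u) psiE _ (psiEc _)).
  by apply: cvgM; [exact: kc|exact: cvg_cst].
pose J u := int01 (fun t => psiE (k t * u)).
have JE x : x \in I -> int01 (fun t => psi (k t * f x)) = J (f x).
  move=> xI; apply: eq_int01 => t /k01/andP[kt0 _]; rewrite /psiE max_r//.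
  by rewrite mulr_ge0 ?f0.
have pos (t : R) : Num.max 0 t \in (`[0, +oo[ : interval R).
  by rewrite in_itv /= le_max lexx.
have psiEm : {homo psiE : s t / s <= t}.
  move=> s t st; apply: pm; rewrite ?pos//.
  by rewrite ge_max !le_max lexx/= st orbT.
have psiE0 t : 0 <= psiE t by apply: p0; exact: pos.
have J0 u : 0 <= J u by exact: int01_ge0.
have Jm : {homo J : u v / u <= v}.
  move=> u v uv; apply: le_int01 => // t /k01/andP[kt0 _].
  by apply: psiEm; rewrite ler_wpM2l.
have Jc : continuous J.
  move=> u.
  have uI : u \in `]u - 1, u + 1[%classic.
    by rewrite inE /= in_itv /= ltrBlDr !ltrDl ltr01.
  (* On []u - 1, u + 1[] the integrand is dominated by the constant [psiE (|u| + 1)], because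
     [0 <= k t <= 1] and [psiE] is nondecreasing. *)
  apply: (@continuity_under_integral R _ _ lebesgue_measure
           (fun v t => psiE (k t * v)) `[0, 1] _ (u - 1) (u + 1) _ _
           (fun=> psiE (`|u| + 1)) _ _ u uI) => //=.
  - by move=> v _; exact: continuous_integrable01.
  - apply: aeW => /= t _ v _; apply: (cvg_comp (fun w => k t * w) psiE _ (psiEc _)).
    by apply: cvgM; [exact: cvg_cst|exact: cvg_id].
  - by apply: continuous_integrable01; exact: cst_continuous.
  - move=> v; rewrite in_itv /= => /andP[uv vu]; apply: aeW => /= t t01.
    rewrite ger0_norm//; apply: psiEm.
    have /andP[kt0 kt1] := k01 _ t01.
    have vb : v <= `|u| + 1 by rewrite (le_trans (ltW vu))// lerD2r ler_norm.
    apply: le_trans (ler_wpM2l kt0 vb) _; apply: ler_piMl kt1.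
    by rewrite addr_ge0.
have gJ : gauge `[0, +oo[ J.
  split=> [//|x y _ _|]; first exact: Jm.
  exact: continuous_subspaceT.
have [h0 hm /subspace_continuousP hc] := gauge_comp _ _ _ gJ gf; split.
- by move=> x xI; rewrite JE// h0.
- by move=> x y xI yI xy; rewrite !JE// hm.
- apply/subspace_continuousP => x xI.
  have : J (f y) @[y --> within [set` I] (nbhs x)] --> J (f x) := hc x xI.
  rewrite -(JE x xI) => hcx.
  apply: cvg_trans (hcx); apply: fmap_within_eq => y.
  by rewrite inE => yI; exact: JE.
Qed.

(** Otherwise the intermediate value theorem produces a point of [[0, c]] with value 1, and
    [f 0 < 1] rules out the point 0. *)
Lemma gauge_lt1 (c : R) f : 0 <= c -> gauge `[0, c] f -> f 0 < 1 ->
  (forall a, 0 < a -> a <= c -> f a != 1) -> f c < 1.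
Proof.
move=> c0 [f0 fm fc] f01 fne; rewrite ltNge; apply/negP => fc1.
have le0c : f 0 <= f c by apply: fm; rewrite ?in_itv /= ?lexx ?c0.
have [|a + fa] := @IVT R f 0 c 1 c0 fc.
  by rewrite min_l// max_r// fc1 ltW.
rewrite in_itv /= => /andP[]; rewrite le_eqVlt => /predU1P[a0|a0] ac.
  by move: f01; rewrite a0 fa ltxx.
by have := fne _ a0 ac; rewrite fa eqxx.
Qed.

End Gauge.

(** * Monotonicity and continuity of the functions [eta_i] *)

Section Radii.
Context {R : realType} (psi0 psi : R -> R).
Hypotheses (psi0_maj : majorant psi0) (psi_maj : majorant psi).

Let psi0_g : gauge `[0, +oo[ psi0 := majorant_gauge _ psi0_maj.
Let psi_g : gauge `[0, +oo[ psi := majorant_gauge _ psi_maj.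

Lemma majorant_ge0 (f : R -> R) : majorant f -> forall t, 0 <= t -> 0 <= f t.
Proof. by case. Qed.

Lemma majorant_le (f : R -> R) : majorant f ->
  forall s t, 0 <= s -> s <= t -> f s <= f t.
Proof.
case=> _ fm _ _ s t s0 st; apply: fm; rewrite // in_itv /= andbT//.
exact: le_trans st.
Qed.

Lemma majorant_lt1 (f : R -> R) (c : R) (I : interval R) (h : R -> R) : majorant f ->
  f c < 1 -> {in I, forall a, 0 <= h a <= c} ->
  {in I, forall a, f (h a) < 1}.
Proof.
move=> fM fc1 hI a /hI/andP[h0 hc].
by apply: le_lt_trans fc1; apply: majorant_le.
Qed.

Lemma gauge_int_psi0 I f : gauge I f ->
  gauge I (fun a => int01 (fun t => psi0 (t * f a) + 1)).
Proof.
move=> gf; apply: (gauge_int01 _ (fun s => psi0 s + 1) id) => //.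
  by apply: gaugeD => //; exact: gauge_cst.
by move=> t; exact: cvg_id.
Qed.

Lemma gauge_int_psi I f : gauge I f ->
  gauge I (fun a => int01 (fun t => psi ((1 - t) * f a))).
Proof.
move=> gf; apply: (gauge_int01 _ psi (fun t => 1 - t)) => //.
  by move=> t; apply: cvgB; [exact: cvg_cst|exact: cvg_id].
move=> t; rewrite in_itv /= => /andP[t0 t1].
by rewrite subr_ge0 t1/= lerBlDr lerDl.
Qed.

Lemma gauge_inv_psi0 (c : R) : psi0 c < 1 ->
  gauge `[0, c] (fun a => (1 - psi0 a)^-1).
Proof.
move=> c1; apply: gauge_inv1B; first by apply: majorant_lt1 c1 _.
by apply: (gauge_comp _ _ id) => //; exact: gauge_id.
Qed.

Lemma gauge_eta1 (c : R) : psi0 c < 1 -> gauge `[0, c] (eta1 psi0 psi).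
Proof.
move=> c1; apply: (gaugeM _ _ _ (gauge_inv_psi0 _ c1)).
apply: gaugeD; last by apply: gauge_int_psi; exact: gauge_id.
apply: gaugeM; first exact: gauge_cst.
by apply: gauge_int_psi0; exact: gauge_id.
Qed.

Lemma le1_mul_itv (c : R) (e : R -> R) : gauge `[0, c] e ->
  {in `[0, c], forall a, e a <= 1} -> {in `[0, c], forall a, 0 <= e a * a <= c}.
Proof.
move=> [e0 _ _] e1 a aI; have := aI; rewrite in_itv /= => /andP[a0 ac].
by rewrite mulr_ge0 ?e0//= (le_trans _ ac)// ler_piMl ?e1.
Qed.

Lemma gauge_mul_id (c : R) (e : R -> R) : gauge `[0, c] e ->
  gauge `[0, c] (fun a => e a * a).
Proof. by move=> ge; apply: (gaugeM _ _ id ge); exact: gauge_id. Qed.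

Lemma gauge_inv_psi0_mul (c : R) (e : R -> R) : psi0 c < 1 ->
  gauge `[0, c] e -> {in `[0, c], forall a, e a <= 1} ->
  gauge `[0, c] (fun a => (1 - psi0 (e a * a))^-1).
Proof.
move=> c1 ge e1; apply: gauge_inv1B.
  by apply: (majorant_lt1 _ _ _ (fun a => e a * a) _ c1) => //; exact: le1_mul_itv.
by apply: gauge_comp => //; exact: gauge_mul_id.
Qed.

(** Reassociation makes [e * a], the bound on the distance from the previous substep to the
    solution, appear as a single argument, as the integral lemmas require. *)
Lemma eta_stepE (e a : R) : eta_step psi0 psi e a =
  (int01 (fun t => psi ((1 - t) * (e * a))) / (1 - psi0 (e * a))
   + (psi (eta1 psi0 psi a * a) + psi (e * a)) / (1 - psi0 (e * a))
     * (int01 (fun t => psi0 (t * (e * a)) + 1) / (1 - p psi0 psi a))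
   + (psi (eta1 psi0 psi a * a) + psi a) / (1 - psi0 a)
     * (int01 (fun t => psi0 (t * (e * a)) + 1) / (1 - p psi0 psi a))) * e.
Proof.
rewrite /eta_step (eq_int01 _ (fun t => psi ((1 - t) * (e * a)))) => [|t _].
  rewrite (eq_int01 (fun t => psi0 (t * e * a) + 1)
                    (fun t => psi0 (t * (e * a)) + 1)) => // t _.
  by rewrite mulrA.
by rewrite mulrA.
Qed.

Section Steps.
Variable c : R.
Hypotheses (c1 : psi0 c < 1).
Hypothesis eta1_le1 : {in `[0, c], forall a, eta1 psi0 psi a <= 1}.

Let gauge_inv_p : gauge `[0, c] (fun a => (1 - p psi0 psi a)^-1).
Proof. by apply: gauge_inv_psi0_mul => //; exact: gauge_eta1. Qed.

Let gauge_psi_eta1 : gauge `[0, c] (fun a => psi (eta1 psi0 psi a * a)).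
Proof. by apply: gauge_comp => //; exact/gauge_mul_id/gauge_eta1. Qed.

Let gauge_psi_id : gauge `[0, c] (fun a => psi a).
Proof. by apply: (gauge_comp _ _ id) => //; exact: gauge_id. Qed.

Lemma gauge_eta2 : gauge `[0, c] (eta2 psi0 psi).
Proof.
apply: (gaugeM _ _ _ (gauge_inv_psi0 _ c1)).
apply: gaugeD; first by apply: gauge_int_psi; exact: gauge_id.
apply: gaugeM => //; apply: gaugeM; first exact: gaugeD.
by apply: gauge_int_psi0; exact: gauge_id.
Qed.

Lemma gauge_eta_step (e : R -> R) : gauge `[0, c] e ->
  {in `[0, c], forall a, e a <= 1} ->
  gauge `[0, c] (fun a => eta_step psi0 psi (e a) a).
Proof.
move=> ge e1; have gea := gauge_mul_id _ _ ge.
have ginv := gauge_inv_psi0_mul _ _ c1 ge e1.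
have gint0 := gauge_int_psi0 _ _ gea.
have gint := gauge_int_psi _ _ gea.
have gpe := gauge_comp _ _ _ psi_g gea.
under eq_fun do rewrite eta_stepE.
have ginv0 := gauge_inv_psi0 _ c1.
by do !(apply: gaugeD || apply: gaugeM).
Qed.

End Steps.

Lemma lt_rho0 (c : R) : 0 <= c -> (c%:E < rho0 psi0)%E -> psi0 c < 1.
Proof.
move=> c0 /ereal_sup_gt[_ [t [t0 t1] <-]]; rewrite lte_fin => ct.
by apply: le_lt_trans t1; apply: majorant_le => //; exact: ltW.
Qed.

(** Starting value for the intermediate value argument. The final factor [e] of [eta_step] passes it
    on to [eta3] and [eta4]. *)
Lemma eta2_0 : eta2 psi0 psi 0 = 0.
Proof.
have [_ _ _ p0] := psi_maj; rewrite /eta2 mulr0 p0 addr0 !mul0r addr0.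
rewrite (eq_int01 _ (fun=> 0)) => [|t _]; last by rewrite mulr0.
by rewrite /int01 Rintegral_cst//= mul0r mulr0.
Qed.


(** * Bounds [eta_i < 1] inside the radius *)

Section Radius.
Variables rho1 rho2 rho3 rho4 : R.
Hypotheses
  (rho1_def : smallest_zero psi0 (dom1 psi0) (H1 psi0 psi) rho1)
  (rho2_def : smallest_zero psi0 (dom2 psi0 psi) (H2 psi0 psi) rho2)
  (rho3_def : smallest_zero psi0 (dom3 psi0 psi) (H3 psi0 psi) rho3)
  (rho4_def : smallest_zero psi0 (dom4 psi0 psi) (H4 psi0 psi) rho4).

Let rho := Num.min (Num.min rho1 rho2) (Num.min rho3 rho4).

Lemma radius_gt0 : 0 < rho.
Proof.
case: rho1_def rho2_def rho3_def rho4_def => [[h1 _ _ _] _] [[h2 _ _ _] _].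
by move=> [[h3 _ _ _] _] [[h4 _ _ _] _]; rewrite /rho !lt_min h1 h2 h3 h4.
Qed.

Lemma radius_lt (a : R) : a < rho -> [/\ a < rho1, a < rho2, a < rho3 & a < rho4].
Proof. by rewrite /rho !lt_min => /andP[/andP[-> ->] /andP[-> ->]]. Qed.

Lemma radius_lt_rho0 (a : R) : a < rho -> (a%:E < rho0 psi0)%E.
Proof.
move=> /radius_lt[a1 _ _ _]; case: rho1_def => -[_ r1 _ _] _.
by apply: lt_trans r1; rewrite lte_fin.
Qed.

Lemma radius_psi0 (a : R) : 0 <= a -> a < rho -> psi0 a < 1.
Proof. by move=> a0 /radius_lt_rho0; exact: lt_rho0. Qed.

(** [eta1] is nondecreasing up to [rho1], where it equals 1, so it is at most 1 before; equality at
    a positive point below [rho1] would contradict the minimality of that zero. *)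
Lemma radius_eta1 (a : R) : 0 <= a -> a < rho -> eta1 psi0 psi a < 1.
Proof.
move=> a0 /radius_lt[a1 _ _ _].
have [[r0 r1 dr Hr] rmin] := rho1_def.
have [_ mono _] := gauge_eta1 _ (lt_rho0 _ (ltW r0) r1).
(* The midpoint replaces [a] because zeros are sought among positive numbers, while [a] may be 0. *)
have [ab br] : a < (a + rho1) / 2 /\ (a + rho1) / 2 < rho1.
  by rewrite midf_lt// midf_lt.
set b := (a + rho1) / 2 in ab br; have b0 : 0 < b by exact: le_lt_trans ab.
have bI : b \in `[0, rho1] by rewrite in_itv /= !ltW.
have le_b : eta1 psi0 psi a <= eta1 psi0 psi b.
  by apply: mono => //; rewrite ?in_itv /= ?a0 ltW.
apply: le_lt_trans le_b _; rewrite lt_neqAle; apply/andP; split.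
  apply/eqP => eb; have : rho1 <= b.
    apply: rmin; split=> //; last by rewrite /H1 eb subrr.
      by apply: lt_trans r1; rewrite lte_fin.
    split; first exact: ltW.
    rewrite lt_eqF//; apply: le_lt_trans (lt_rho0 _ (ltW r0) r1).
    by apply: majorant_le => //; exact: ltW.
  by rewrite leNgt br.
suff <- : eta1 psi0 psi rho1 = 1.
  by apply: mono => //; rewrite ?in_itv /= ?lexx ltW.
by apply/eqP; rewrite -subr_eq0; apply/eqP.
Qed.

Lemma radius_dom (a : R) : 0 <= a -> a < rho -> dom1 psi0 a.
Proof. by move=> a0 ar; split=> //; rewrite lt_eqF// radius_psi0. Qed.

Let le1_itv (f : R -> R) : (forall a, 0 <= a -> a < rho -> f a < 1) ->
  forall c, c < rho -> {in `[0, c], forall a, f a <= 1}.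
Proof.
move=> f1 c cr a; rewrite in_itv /= => /andP[a0 ac].
by rewrite ltW// f1// (le_lt_trans ac).
Qed.

Let psi0_mul_lt1 (e a : R) : 0 <= e -> e < 1 -> 0 <= a -> a < rho ->
  psi0 (e * a) < 1.
Proof.
move=> e0 e1 a0 ar; apply: le_lt_trans (radius_psi0 _ a0 ar).
by apply: majorant_le; rewrite ?mulr_ge0// ler_piMl// ltW.
Qed.

Let gauge_ge0 (c : R) (f : R -> R) : 0 <= c -> gauge `[0, c] f -> 0 <= f c.
Proof. by move=> c0 [f0 _ _]; apply: f0; rewrite in_itv /= c0 lexx. Qed.

Lemma radius_gauge1 (c : R) : 0 <= c -> c < rho -> gauge `[0, c] (eta1 psi0 psi).
Proof. by move=> c0 cr; apply: gauge_eta1; exact: radius_psi0. Qed.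

Lemma radius_gauge2 (c : R) : 0 <= c -> c < rho -> gauge `[0, c] (eta2 psi0 psi).
Proof.
move=> c0 cr; apply: gauge_eta2; first exact: radius_psi0.
by apply: le1_itv cr; exact: radius_eta1.
Qed.

(** A point below [rho] where [f] equals 1 would be a zero smaller than [r]. It must also lie in
    [dom], which for [eta_i] follows from [eta_(i-1) < 1]; hence regularity, domain and bound are
    established in turn for each successive index. *)
Let lt1_before_zero (dom : R -> Prop) (f : R -> R) r :
  smallest_zero psi0 dom (fun a => f a - 1) r -> rho <= r ->
  (forall c, 0 <= c -> c < rho -> gauge `[0, c] f) ->
  (forall c, 0 <= c -> c < rho -> dom c) -> f 0 = 0 ->
  forall a, 0 <= a -> a < rho -> f a < 1.
Proof.
move=> [_ rmin] rho_r gf df f0 a a0 ar.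
apply: gauge_lt1 => //; [exact: gf|by rewrite f0|move=> b b0 ba].
have br : b < rho by exact: le_lt_trans ar.
apply/eqP => fb; have : r <= b.
  apply: rmin; split=> //; [exact: radius_lt_rho0|exact/df/br/ltW|].
  by rewrite fb subrr.
by rewrite leNgt (lt_le_trans br).
Qed.

Lemma radius_dom2 (a : R) : 0 <= a -> a < rho -> dom2 psi0 psi a.
Proof.
move=> a0 ar; have e0 := gauge_ge0 _ _ a0 (radius_gauge1 _ a0 ar).
have e1 := radius_eta1 _ a0 ar.
split; [exact: radius_dom|exact: mulr_ge0|].
by rewrite lt_eqF// psi0_mul_lt1.
Qed.

Lemma radius_eta2 (a : R) : 0 <= a -> a < rho -> eta2 psi0 psi a < 1.
Proof.
apply: (lt1_before_zero _ _ _ rho2_def) => //; last exact: eta2_0.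
- by rewrite /rho !ge_min lexx ?orbT.
- exact: radius_gauge2.
- exact: radius_dom2.
Qed.

Lemma radius_gauge3 (c : R) : 0 <= c -> c < rho -> gauge `[0, c] (eta3 psi0 psi).
Proof.
move=> c0 cr; apply: gauge_eta_step; first exact: radius_psi0.
- by apply: le1_itv cr; exact: radius_eta1.
- exact: radius_gauge2.
- by apply: le1_itv cr; exact: radius_eta2.
Qed.

Lemma radius_dom3 (a : R) : 0 <= a -> a < rho -> dom3 psi0 psi a.
Proof.
move=> a0 ar; have e0 := gauge_ge0 _ _ a0 (radius_gauge2 _ a0 ar).
have e1 := radius_eta2 _ a0 ar.
split; [exact: radius_dom2|exact: mulr_ge0|].
by rewrite lt_eqF// psi0_mul_lt1.
Qed.

Lemma radius_eta3 (a : R) : 0 <= a -> a < rho -> eta3 psi0 psi a < 1.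
Proof.
apply: (lt1_before_zero _ _ _ rho3_def) => //.
- by rewrite /rho !ge_min lexx ?orbT.
- exact: radius_gauge3.
- exact: radius_dom3.
- by rewrite /eta3 eta2_0 /eta_step mulr0.
Qed.

Lemma radius_gauge4 (c : R) : 0 <= c -> c < rho -> gauge `[0, c] (eta4 psi0 psi).
Proof.
move=> c0 cr; apply: gauge_eta_step; first exact: radius_psi0.
- by apply: le1_itv cr; exact: radius_eta1.
- exact: radius_gauge3.
- by apply: le1_itv cr; exact: radius_eta3.
Qed.

Lemma radius_dom4 (a : R) : 0 <= a -> a < rho -> dom4 psi0 psi a.
Proof.
move=> a0 ar; have e0 := gauge_ge0 _ _ a0 (radius_gauge3 _ a0 ar).
have e1 := radius_eta3 _ a0 ar.
split; [exact: radius_dom3|exact: mulr_ge0|].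
by rewrite lt_eqF// psi0_mul_lt1.
Qed.

Lemma radius_eta4 (a : R) : 0 <= a -> a < rho -> eta4 psi0 psi a < 1.
Proof.
apply: (lt1_before_zero _ _ _ rho4_def) => //.
- by rewrite /rho !ge_min lexx ?orbT.
- exact: radius_gauge4.
- exact: radius_dom4.
- by rewrite /eta4 /eta3 eta2_0 /eta_step !mulr0.
Qed.

Lemma radius_etas (a : R) : 0 <= a -> a < rho ->
  [/\ 0 <= eta1 psi0 psi a < 1, 0 <= eta2 psi0 psi a < 1,
      0 <= eta3 psi0 psi a < 1 & 0 <= eta4 psi0 psi a < 1].
Proof.
move=> a0 ar; split.
- by rewrite radius_eta1// gauge_ge0//; exact: radius_gauge1.
- by rewrite radius_eta2// gauge_ge0//; exact: radius_gauge2.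
- by rewrite radius_eta3// gauge_ge0//; exact: radius_gauge3.
- by rewrite radius_eta4// gauge_ge0//; exact: radius_gauge4.
Qed.

End Radius.

End Radii.

(** * Mean value inequality *)

Section MeanValue.
Context {R : realType}.

(** A local-to-global principle without derivatives, so that it applies to expressions containing a
    norm. The proof takes the supremum of the points of [0, 1] where [f] is at most [f 0]. *)
Lemma near_nincr_le01 (f : R -> R) :
  (forall t : R, 0 <= t <= 1 -> \forall u \near t,
     (t <= u -> f u <= f t) /\ (u <= t -> f t <= f u)) ->
  f 1 <= f 0.
Proof.
move=> fn; pose S := [set t | 0 <= t <= 1 /\ f t <= f 0].
have S0 : S 0 by rewrite /S /= !lexx ler01.
have S1 : ubound S 1 by move=> t [/andP[]].
have supS : has_sup S by split; [exists 0|exists 1].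
pose s := sup S.
have s0 : 0 <= s by exact: sup_upper_bound.
have s1 : s <= 1 by apply: ge_sup => //; exists 0.
have s01 : 0 <= s <= 1 by rewrite s0.
have /nbhs_ballP[d /= d0 sd] := fn s s01.
(* Comparison to the left of [s] shows that the supremum belongs to [S]. *)
have fs : f s <= f 0.
  have [t St ts] := sup_adherent d0 supS.
  have t_s : t <= s by exact: sup_upper_bound.
  have [|_ /(_ t_s) fst] := sd t; last by apply: le_trans fst _; case: St.
  by rewrite /ball /= ger0_norm ?subr_ge0// ltrBlDr addrC -ltrBlDr.
have [->//|sn1] := eqVneq 1 s.
have {sn1}s_lt1 : s < 1 by rewrite lt_neqAle s1 andbT eq_sym.
(* If [s < 1], comparison to the right of [s] puts [u] in [S], beyond its supremum. *)
pose u := Num.min 1 (s + d / 2).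
have su : s < u by rewrite /u lt_min s_lt1 ltrDl divr_gt0.
have u1 : u <= 1 by rewrite /u ge_min lexx.
have [|/(_ (ltW su)) fu _] := sd u.
  rewrite /ball /= distrC ger0_norm ?subr_ge0 ?ltW//.
  rewrite ltrBlDl (@le_lt_trans _ _ (s + d / 2))//; first by rewrite ge_min lexx orbT.
  by rewrite ltrD2l gtr_pMr// invf_lt1 ?ltr1n.
have : u <= s.
  apply: sup_upper_bound => //; split; first by rewrite (le_trans s0)//= ltW.
  exact: le_trans fs.
by rewrite leNgt su.
Qed.

Lemma near_increment (V : normedModType R) (F : R -> V) (t e : R) :
  derivable F t 1 -> 0 < e ->
  \forall u \near t, `|F u - F t - (u - t) *: 'D_1 F t| <= e * `|u - t|.
Proof.
move=> /derivable_nbhs/eqaddoP dF e0; apply/nbhs0P.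
have := dF _ e0; apply: filterS => h.
have -> : t + h - t = h by rewrite addrAC subrr add0r.
move=> dFh; rewrite [t + h]addrC -{1}(mulr1 h) -addrA -opprD.
exact: dFh.
Qed.

(** With [G] a primitive of [g], the increment of the norm of [F t - F 0] is locally dominated by
    that of [G], up to an arbitrarily small linear term. *)
Lemma norm_increment_le_int01 (V : normedModType R) (F : R -> V) (g : R -> R) :
  continuous g ->
  {in `[0, 1], forall t, derivable F t 1 /\ `|'D_1 F t| <= g t} ->
  `|F 1 - F 0| <= int01 g.
Proof.
move=> gc dF.
have gi a b : lebesgue_measure.-integrable `[a, b] (EFin \o g).
  apply: continuous_compact_integrable; first exact: segment_compact.
  exact: continuous_subspaceT.
(* Starting at -1 makes 0 an interior point, so that [G] has a two-sided derivative on all of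
   [0, 1]. *)
pose G x := \int[lebesgue_measure]_(t in `[-1, x]) g t.
have GE : G 1 - G 0 = int01 g.
  rewrite /G Rintegral_itvB ?bnd_simp//.
  rewrite /int01 Rintegral_itv_obnd_cbnd//.
  by apply: integrableS (gi 0 1) => //; apply: subset_itvr; rewrite bnd_simp.
have dG t : t \in `[0, 1] -> derivable G t 1 /\ 'D_1 G t = g t.
  rewrite in_itv /= => /andP[t0 t1].
  have [|||d1 d2] := @continuous_FTC1_closed R g (-1) t 2 _ (gi _ _).
  - by rewrite (le_lt_trans t1)// ltr1n.
  - by rewrite (lt_le_trans _ t0)// ltrN10.
  - exact: gc.
  - by split; rewrite -?derive1E.
rewrite -GE; apply/ler_addgt0Pr => e e0.
(* The slack [e * t] absorbs the first-order errors of [F] and [G], each at most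
   [e / 2 * |u - t|]. *)
pose f t := `|F t - F 0| - (G t - G 0) - e * t.
suff : f 1 <= f 0.
  rewrite /f !subrr normr0 mulr0 mulr1 !subr0 lerBlDr lerBlDr add0r addrC.
  by rewrite [e + _]addrC.
apply: near_nincr_le01 => t t01.
have [dFt Fg] := dF t t01; have [dGt Gg] := dG t t01.
have e2 : 0 < e / 2 by rewrite divr_gt0.
have := near_increment _ _ _ _ dGt e2; have := near_increment _ _ _ _ dFt e2.
apply: filterS2 => u.
rewrite Gg => Fu Gu.
have Nu : `|F u - F t| <= `|u - t| * g t + e / 2 * `|u - t|.
  rewrite -(subrK ((u - t) *: 'D_1 F t) (F u - F t)) addrC.
  apply: le_trans (ler_normD _ _) _; apply: lerD => //.
  by rewrite normrZ ler_wpM2l.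
have {Gu}/andP[Gu1 Gu2] :
    - (e / 2 * `|u - t|) <= G u - G t - (u - t) * g t <= e / 2 * `|u - t|.
  by rewrite -ler_norml.
have Fut : `|F u - F 0| <= `|F t - F 0| + `|F u - F t|.
  by rewrite [leRHS]addrC ler_distD.
have Ftu : `|F t - F 0| <= `|F u - F 0| + `|F u - F t|.
  by rewrite [leRHS]addrC [`|F u - F t|]distrC ler_distD.
rewrite /f; split=> [tu|ut].
  rewrite ger0_norm ?subr_ge0// in Nu Gu1 Gu2; lra.
rewrite ler0_norm ?subr_le0// in Nu Gu1 Gu2; lra.
Qed.

End MeanValue.

(** * Inverses of perturbed operators *)

Section Operators.
Context {R : realType}.

(** Normalizing [v] reduces to the unit ball. Linearity enters as plain homogeneity, so that
    compositions with [opinv], which are bare functions, are covered. *)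
Lemma le_opnorm (V W : normedModType R) (f : V -> W) (c : R) (v : V) :
  (forall (k : R) u, f (k *: u) = k *: f u) -> (opnorm f <= c%:E)%E ->
  `|f v| <= c * `|v|.
Proof.
move=> fZ fc; have [->|v0] := eqVneq v 0.
  by have := fZ 0 0; rewrite !scale0r => ->; rewrite !normr0 mulr0.
have nv0 : 0 < `|v| by rewrite normr_gt0.
have : (`|f (`|v|^-1 *: v)|%:E <= c%:E)%E.
  apply: le_trans fc; apply: ereal_sup_ubound; exists (`|v|^-1 *: v) => //=.
  by rewrite normrZ normfV normr_id mulVf// gt_eqF.
by rewrite lee_fin fZ normrZ normfV normr_id mulrC ler_pdivrMr.
Qed.

Lemma opinvK (X Y : normedModType R) (A : X -> Y) : bijective A ->
  cancel A (opinv A).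
Proof. by move=> /bij_inj Ai x; apply: pinvKV; rewrite ?inE// => ? ? _ _ /Ai. Qed.

Lemma opinvKV (X Y : normedModType R) (A : X -> Y) : bijective A ->
  cancel (opinv A) A.
Proof.
case=> g _ gK y; apply: (@surjpK _ _ _ setT setT); rewrite ?inE//.
by move=> z _; exists (g z).
Qed.

(** Supplies a bundled linear map equal to [opinv A], to which the rewriting rules for linear maps
    apply. *)
Lemma opinv_linear (X Y : normedModType R) (A : {linear X -> Y}) :
  bijective A -> {B : {linear Y -> X} | B = opinv A :> (Y -> X)}.
Proof.
move=> Ab; have lin : linear (opinv A).
  move=> k u v; apply: (bij_inj Ab).
  by rewrite linearP !opinvKV.
pose m := GRing.isLinear.Build _ _ _ _ _ lin.
by exists (HB.pack (opinv A) m : {linear Y -> X}).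
Qed.

Lemma lipschitz_linear_continuous (V W : normedModType R) (f : {linear V -> W})
  (k : R) : (forall v, `|f v| <= k * `|v|) -> continuous f.
Proof.
move=> fk; apply: bounded_linear_continuous; apply/linear_boundedP.
near=> r => v; apply: le_trans (fk v) (ler_wpM2r (normr_ge0 _) _).
by near: r; apply: nbhs_pinfty_ge; exact: num_real.
Unshelve. all: by end_near. Qed.

(* Banach's lemma: [v |-> v + A^-1 (w - L v)] is a contraction whose fixed point
   is a preimage of [w] under [L]. *)
Lemma perturbed_inverse (X : completeNormedModType R) (Y : normedModType R)
    (A L : {linear X -> Y}) (q : R) :
  has_bounded_inverse A -> 0 <= q -> q < 1 ->
  (forall v, `|opinv A (L v - A v)| <= q * `|v|) ->
  has_bounded_inverse L /\
  forall w, `|opinv L w| <= `|opinv A w| / (1 - q).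
Proof.
move=> [Ab cB] q0 q1 LA.
have [B BE] := opinv_linear _ _ _ Ab.
have BA v : B (A v) = v by rewrite BE opinvK.
have Binj : injective B by rewrite BE; exact: can_inj (opinvKV _ _ _ Ab).
rewrite -BE in cB LA *.
(* This lower bound yields both the injectivity of [L] and the estimate on its inverse. *)
have lower v : (1 - q) * `|v| <= `|B (L v)|.
  have := ler_normB (B (L v)) (B (L v - A v)).
  rewrite linearB /= BA opprB addrC subrK => lev.
  by have := LA v; rewrite linearB /= BA; lra.
have q1' : 0 < 1 - q by rewrite subr_gt0.
have Linj : injective L.
  move=> u v uv; apply/eqP; rewrite -subr_eq0 -normr_le0.
  have := lower (u - v).
  by rewrite linearB uv subrr linear0 normr0 pmulr_rle0.
have Lsurj w : exists v, L v = w.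
  pose f v := B w - B (L v - A v).
  have fT : {homo f : x / [set: X] x >-> [set: X] x} by [].
  have [|||v _ fv] := @banach_fixed_point R X setT (mkfun_fun fT).
  - exists (NngNum q0); split => //= -[u v] _ /=.
    have -> : f u - f v = B (L (v - u) - A (v - u)).
      rewrite /f !linearB /= !BA !opprK addrACA subrr add0r addrACA.
      by rewrite [- B _ + _]addrC [u - v]addrC.
    by rewrite [`|u - v|]distrC.
  - exact: closedT.
  - by exists 0.
  - exists v; apply: Binj; have {fv} : v = f v := fv.
    rewrite /f linearB /= BA opprB addrCA => /(congr1 (fun z => z - v)).
    by rewrite /= subrr [v + _]addrC addrK => /esym/subr0_eq.
have Lb : bijective L.
  pose g w := projT1 (cid (Lsurj w)).
  have gK w : L (g w) = w by rewrite /g; case: cid.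
  by exists g => // v; apply: Linj; rewrite gK.
have bound w : `|opinv L w| <= `|B w| / (1 - q).
  by rewrite ler_pdivlMr// mulrC -{2}(opinvKV _ _ _ Lb w).
split=> //; split=> //.
have [M ME] := opinv_linear _ _ _ Lb; rewrite -ME in bound *.
have [k k0 Bk] := linear_lipschitz cB.
apply: (lipschitz_linear_continuous _ _ _ (k / (1 - q))) => v.
by apply: le_trans (bound v) _; rewrite mulrAC ler_wpM2r// invr_ge0 ltW.
Qed.
End Operators.

(** * Error estimates for the iteration *)

Lemma convex_segment (R : realType) (V : normedModType R) (D : set V) (x z : V)
    (t : R) : convex_set D -> D x -> D z -> 0 <= t -> t <= 1 ->
  D (x + t *: (z - x)).
Proof.
move=> Dc Dx Dz t0 t1.
have t01 : Itv.spec (@Itv.num_sem R) (Itv.Real `[0%Z, 1%Z]) t.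
  by rewrite /Itv.spec /= /Itv.num_sem /= num_real /= in_itv /= t0 t1.
have := Dc z x (Itv.mk t01); rewrite !inE => /(_ Dz Dx).
suff -> : x + t *: (z - x) = t *: z + (1 - t) *: x :> V by [].
by rewrite scalerBr scalerBl scale1r addrCA.
Qed.

(** The mean value inequality in the shape shared by all residual estimates: the weight [k] measures
    how far the point of the segment lies from the reference point. *)
Lemma norm_increment_le_gauge (R : realType) (V : normedModType R) (F : R -> V)
    (psi k : R -> R) (b c : R) :
  gauge `[0, +oo[ psi -> continuous k -> {in `[0, 1], forall t, 0 <= k t} ->
  0 <= b -> 0 <= c ->
  {in `[0, 1], forall t, derivable F t 1 /\ `|'D_1 F t| <= psi (k t * b) * c} ->
  `|F 1 - F 0| <= int01 (fun t => psi (k t * b)) * c.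
Proof.
move=> gpsi kc k0 b0 c0 dF.
pose g (t : R) := psi (Num.max 0 (k t * b)).
have gE : {in `[0, 1], forall t, psi (k t * b) = g t}.
  by move=> t t01; rewrite /g max_r// mulr_ge0// k0.
have gc : continuous g.
  move=> t; apply: (cvg_comp (fun s => k s * b) (fun s => psi (Num.max 0 s))
                             _ (gauge_max0_continuous _ gpsi _)).
  by apply: cvgM; [exact: kc|exact: cvg_cst].
rewrite (eq_int01 _ g) => [|//].
rewrite /int01 -RintegralZr//=; last exact: continuous_integrable01.
apply: norm_increment_le_int01 => [t|t t01].
  by apply: cvgM; [exact: gc|exact: cvg_cst].
by have [] := dF t t01; rewrite gE.
Qed.

(** * Residuals, Newton steps and differences of inverses near the solution *)

Section Newton.
Context {R : realType} {X Y : completeNormedModType R}.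
Variables (D : set X) (T : X -> Y) (xs : X) (psi0 psi : R -> R).
Hypotheses (D_convex : convex_set D) (T_C1 : continuously_differentiable_on D T)
  (D_xs : D xs) (T_xs : T xs = 0) (dT_xs : has_bounded_inverse ('d T xs))
  (psi0_maj : majorant psi0) (psi_maj : majorant psi).
Hypothesis center_lip : forall x, D x ->
  (opnorm (opinv ('d T xs) \o ('d T x \- 'd T xs))%R <= (psi0 `|x - xs|%R)%:E)%E.
Hypothesis lip : forall x y,
  (D `&` eball xs (rho0 psi0)) x -> (D `&` eball xs (rho0 psi0)) y ->
  (opnorm (opinv ('d T xs) \o ('d T x \- 'd T y))%R <= (psi `|x - y|%R)%:E)%E.

Let A : {linear X -> Y} := 'd T xs.
Let B : {linear Y -> X} := projT1 (opinv_linear _ _ A dT_xs.1).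

Let BE : B = opinv A :> (Y -> X).
Proof. by rewrite /B; case: opinv_linear. Qed.

Let cB : continuous B.
Proof. by rewrite BE; case: dT_xs. Qed.

Let BA v : B (A v) = v.
Proof. by rewrite BE opinvK//; case: dT_xs. Qed.

Let B_sub x y v : B ('d T x v - 'd T y v) =
  (opinv ('d T xs) \o ('d T x \- 'd T y)) v.
Proof. by rewrite -/A -BE. Qed.

Let opZ x y (k : R) v : (opinv ('d T xs) \o ('d T x \- 'd T y)) (k *: v) =
  k *: (opinv ('d T xs) \o ('d T x \- 'd T y)) v.
Proof. by rewrite -!B_sub !linearZ_LR /= -scalerDr linearZ_LR. Qed.

Let center_le x v : D x -> `|B ('d T x v - A v)| <= psi0 `|x - xs| * `|v|.
Proof. by move=> Dx; rewrite B_sub le_opnorm//; exact: center_lip. Qed.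

(* Points at which both Lipschitz conditions are available, with a majorant of
   the distance to the solution. *)
Definition near_solution (b : R) (x : X) : Prop :=
  [/\ D x, `|x - xs| <= b & (b%:E < rho0 psi0)%E].

Lemma near_solution_D0 b x : near_solution b x -> (D `&` eball xs (rho0 psi0)) x.
Proof.
move=> [Dx xb b0]; split=> //; rewrite /eball /=; apply: le_lt_trans b0.
by rewrite lee_fin distrC.
Qed.

Lemma near_solution_self : (0%:E < rho0 psi0)%E -> near_solution 0 xs.
Proof. by move=> r0; split=> //; rewrite subrr normr0. Qed.

Lemma near_solution_ge0 b x : near_solution b x -> 0 <= b.
Proof. by case=> _ xb _; exact: le_trans xb. Qed.

Lemma near_solution_lt1 b x : near_solution b x -> psi0 b < 1.
Proof.
by move=> xb; apply: lt_rho0 => //; [exact: near_solution_ge0 xb|case: xb].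
Qed.

Let lip_le b x c y v : near_solution b x -> near_solution c y ->
  `|B ('d T x v - 'd T y v)| <= psi `|x - y| * `|v|.
Proof.
move=> /near_solution_D0 Dx /near_solution_D0 Dy.
by rewrite B_sub le_opnorm//; exact: lip.
Qed.

Lemma near_solution_inverse b x : near_solution b x ->
  has_bounded_inverse ('d T x) /\
  forall w, `|opinv ('d T x) w| <= `|opinv ('d T xs) w| / (1 - psi0 b).
Proof.
move=> xb; have [Dx xsb _] := xb; have b0 := near_solution_ge0 _ _ xb.
apply: (perturbed_inverse _ _ A) => //; first exact: majorant_ge0.
  exact: near_solution_lt1 xb.
move=> v; rewrite -BE; apply: le_trans (center_le _ v Dx) _.
by apply: ler_wpM2r => //; apply: majorant_le.
Qed.

Let segment_derive x h t : D (x + t *: h) ->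
  derivable (fun s : R => B (T (x + s *: h))) t 1 /\
  'D_1 (fun s : R => B (T (x + s *: h))) t = B ('d T (x + t *: h) h).
Proof.
move=> Dt; have [dT _] := T_C1 _ Dt.
have dl : is_diff t (fun s : R => x + s *: h) ( *:%R^~ h).
  apply: is_diff_eq (is_diffD (is_diff_cst x t) (is_diff_scalel t h)) _.
  by apply/funext => s /=; rewrite fctE add0r.
have dTl := is_diff_comp dl (differentiableP dT).
have dBt : is_diff (T (x + t *: h)) B B.
  by apply: DiffDef; [exact: linear_differentiable|exact: diff_lin].
have dF : is_diff t (fun s : R => B (T (x + s *: h)))
                  (fun s => B ('d T (x + t *: h) (s *: h))).
  exact: is_diff_comp dTl dBt.
split; first by apply: diff_derivable; exact: ex_diff.
rewrite deriveE; last exact: ex_diff.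
by rewrite diff_val /= scale1r.
Qed.

(** Along the segment from [xs] to [x] the derivative of [B T] in the direction [h] is
    [h + B (T' - A) h], of norm at most [(1 + psi0 (t * b)) * b]. *)
Lemma residual_le b x : D x -> `|x - xs| <= b ->
  `|opinv ('d T xs) (T x)| <= int01 (fun t => psi0 (t * b) + 1) * b.
Proof.
move=> Dx xb; have b0 : 0 <= b by exact: le_trans xb.
pose h := x - xs; rewrite -/A -BE.
pose F (t : R) := B (T (xs + t *: h)).
have -> : B (T x) = F 1 - F 0.
  by rewrite /F scale0r addr0 T_xs linear0 subr0 scale1r /h addrC subrK.
apply: (norm_increment_le_gauge _ _ _ (fun s => psi0 s + 1) id) => //.
- by apply: gaugeD; [exact: majorant_gauge|exact: gauge_cst].
- by move=> t; exact: cvg_id.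
- by move=> t; rewrite in_itv /= => /andP[].
move=> t; rewrite in_itv /= => /andP[t0 t1].
have Dt : D (xs + t *: h) by exact: convex_segment.
have [dF ->] := segment_derive _ _ _ Dt; split=> //.
rewrite -(subrK (A h) ('d T _ h)) linearD BA.
apply: le_trans (ler_normD _ _) _; rewrite mulrDl mul1r; apply: lerD => //.
apply: le_trans (center_le _ h Dt) _; apply: ler_pM => //.
  exact: majorant_ge0.
apply: majorant_le => //; rewrite addrC addKr normrZ ger0_norm//.
exact: ler_wpM2l.
Qed.

(** The derivative of [F] is [B (T'(x) - T'(xs + t h)) h]. The two points differ by [(1 - t) h],
    whence the weight [1 - t]. *)
Lemma newton_residual_le b x : near_solution b x ->
  `|opinv ('d T xs) ('d T x (x - xs) - T x)| <=
    int01 (fun t => psi ((1 - t) * b)) * b.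
Proof.
move=> xb; have [Dx xsb br] := xb; have b0 := near_solution_ge0 _ _ xb.
pose h := x - xs; rewrite -/A -BE -/h.
pose F (t : R) := t *: B ('d T x h) - B (T (xs + t *: h)).
have -> : B ('d T x h - T x) = F 1 - F 0.
  rewrite /F !scale0r addr0 T_xs linear0 !subr0 !scale1r linearB.
  by rewrite [xs + h]addrC subrK.
apply: (norm_increment_le_gauge _ _ _ psi (fun t => 1 - t)) => //.
- exact: majorant_gauge.
- by move=> t; apply: cvgB; [exact: cvg_cst|exact: cvg_id].
- by move=> t; rewrite in_itv /= subr_ge0 => /andP[].
move=> t; rewrite in_itv /= => /andP[t0 t1].
have Dt : D (xs + t *: h) by exact: convex_segment.
have tb : near_solution b (xs + t *: h).
  split=> //; rewrite addrC addKr normrZ ger0_norm//.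
  by apply: le_trans xsb; rewrite ler_piMl.
have [dBT BTE] := segment_derive _ _ _ Dt.
pose l (s : R) : X := s *: B ('d T x h).
have dl : is_diff t l l by exact: is_diff_scalel.
have dl1 : derivable l t 1 by apply: diff_derivable; exact: ex_diff.
split; first by apply: (derivableB (f := l)).
have -> : F = l - (fun s : R => B (T (xs + s *: h))) by [].
rewrite deriveB// BTE deriveE; last exact: ex_diff.
rewrite diff_val /l scale1r -linearB.
apply: le_trans (lip_le _ _ _ _ h xb tb) _; apply: ler_pM => //.
  exact: majorant_ge0.
apply: majorant_le => //.
rewrite opprD addrA -/h -{1}(scale1r h) -scalerBl normrZ.
by rewrite ger0_norm ?subr_ge0// ler_wpM2l// subr_ge0.
Qed.

(** The error after a Newton step is the inverse of [T'(x)] applied to the linearization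
    residual. *)
Lemma newton_step_le b x : near_solution b x ->
  `|x - xs - opinv ('d T x) (T x)| <=
    int01 (fun t => psi ((1 - t) * b)) / (1 - psi0 b) * b.
Proof.
move=> xb; have [[Lb _] Linv] := near_solution_inverse _ _ xb.
have [M ME] := opinv_linear _ _ _ Lb.
have -> : x - xs - opinv ('d T x) (T x) =
          opinv ('d T x) ('d T x (x - xs) - T x).
  by rewrite -ME [in RHS]linearB ME opinvK.
apply: le_trans (Linv _) _; rewrite mulrAC ler_wpM2r//.
  by rewrite invr_ge0 subr_ge0 ltW// (near_solution_lt1 _ _ xb).
exact: newton_residual_le.
Qed.

Lemma inverse_difference_le b x c y w : near_solution b x ->
  near_solution c y ->
  `|opinv ('d T x) w - opinv ('d T y) w| <=
    (psi c + psi b) / (1 - psi0 b) * (`|opinv ('d T xs) w| / (1 - psi0 c)).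
Proof.
move=> xb yc; have [[Lxb _] Lxinv] := near_solution_inverse _ _ xb.
have [[Lyb _] Lyinv] := near_solution_inverse _ _ yc.
have [M ME] := opinv_linear _ _ _ Lxb.
pose v := opinv ('d T y) w.
have -> : opinv ('d T x) w - v = opinv ('d T x) ('d T y v - 'd T x v).
  by rewrite -ME [in RHS]linearB ME opinvK// /v opinvKV.
have r0 : (0%:E < rho0 psi0)%E.
  by case: xb => _ xb' xr; apply: le_lt_trans xr; rewrite lee_fin (le_trans _ xb').
have xs0 := near_solution_self r0.
apply: le_trans (Lxinv _) _; rewrite mulrAC ler_wpM2r//.
  by rewrite invr_ge0 subr_ge0 ltW// (near_solution_lt1 _ _ xb).
apply: (@le_trans _ _ ((psi c + psi b) * `|v|)); last first.
  apply: ler_wpM2l (Lyinv w); apply: addr_ge0; apply: majorant_ge0 => //.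
    exact: near_solution_ge0 yc.
  exact: near_solution_ge0 xb.
rewrite -/A -BE.
(* Passing through [xs] replaces the distance between [x] and [y] by their distances to the
   solution, giving the sum [psi c + psi b] of the [eta_i]. *)
have -> : 'd T y v - 'd T x v = ('d T y v - 'd T xs v) + ('d T xs v - 'd T x v).
  by rewrite addrA subrK.
rewrite linearD mulrDl.
apply: le_trans (ler_normD _ _) _; apply: lerD.
  apply: le_trans (lip_le _ _ _ _ v yc xs0) _; rewrite ler_wpM2r//.
  by apply: majorant_le => //; case: yc.
apply: le_trans (lip_le _ _ _ _ v xs0 xb) _; rewrite ler_wpM2r//.
by rewrite distrC; apply: majorant_le => //; case: xb.
Qed.

Lemma inverse_difference_residual_le b x c y d z : near_solution b x ->
  near_solution c y -> near_solution d z ->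
  `|opinv ('d T x) (T z) - opinv ('d T y) (T z)| <=
    (psi c + psi b) / (1 - psi0 b)
      * (int01 (fun t => psi0 (t * d) + 1) / (1 - psi0 c)) * d.
Proof.
move=> xb yc zd; apply: le_trans (inverse_difference_le _ _ _ _ _ xb yc) _.
have [Dz zsd _] := zd.
have inv_ge0 e u : near_solution e u -> 0 <= (1 - psi0 e)^-1.
  by move=> ue; rewrite invr_ge0 subr_ge0 ltW// (near_solution_lt1 _ _ ue).
rewrite -[leRHS]mulrA ler_wpM2l//.
  rewrite mulr_ge0// ?(inv_ge0 _ _ xb)// addr_ge0// majorant_ge0//.
    exact: near_solution_ge0 yc.
  exact: near_solution_ge0 xb.
by rewrite mulrAC ler_wpM2r// ?(inv_ge0 _ _ yc)// residual_le.
Qed.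

(** Half a Newton step is a full one with half the Newton correction added back; the two pieces give
    the two integrals in [eta1]. *)
Lemma iter_y_le x a : near_solution a x ->
  `|iter_y T x - xs| <= eta1 psi0 psi a * a.
Proof.
move=> xa; have [Dx xsa _] := xa; rewrite /iter_y.
have -> : x - 2^-1 *: opinv ('d T x) (T x) - xs =
    (x - xs - opinv ('d T x) (T x)) + 2^-1 *: opinv ('d T x) (T x).
  rewrite [LHS]addrAC -[RHS]addrA; congr (_ + _).
  rewrite -[X in _ = - X + _]scale1r -!scaleNr -scalerDl.
  by congr (_ *: _); lra.
apply: le_trans (ler_normD _ _) _.
have -> : eta1 psi0 psi a * a =
    int01 (fun t => psi ((1 - t) * a)) / (1 - psi0 a) * a
    + 2^-1 * (int01 (fun t => psi0 (t * a) + 1) * a / (1 - psi0 a)).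
  by rewrite /eta1; ring.
apply: lerD; first exact: newton_step_le.
rewrite normrZ ger0_norm ?invr_ge0// ler_wpM2l ?invr_ge0//.
have [_ Linv] := near_solution_inverse _ _ xa.
apply: le_trans (Linv _) _; rewrite ler_wpM2r ?residual_le//.
by rewrite invr_ge0 subr_ge0 ltW// (near_solution_lt1 _ _ xa).
Qed.

(** A Newton step at [x], plus the difference of the inverses at [x] and [y] applied to [T x]. *)
Lemma iter_z1_le x a : near_solution a x ->
  near_solution (eta1 psi0 psi a * a) (iter_y T x) ->
  `|iter_z1 T x - xs| <= eta2 psi0 psi a * a.
Proof.
move=> xa ya; rewrite /iter_z1.
have -> : x - opinv ('d T (iter_y T x)) (T x) - xs =
    (x - xs - opinv ('d T x) (T x))
    + (opinv ('d T x) (T x) - opinv ('d T (iter_y T x)) (T x)).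
  by rewrite addrA subrK addrAC.
apply: le_trans (ler_normD _ _) _.
have -> : eta2 psi0 psi a * a =
    int01 (fun t => psi ((1 - t) * a)) / (1 - psi0 a) * a
    + (psi (eta1 psi0 psi a * a) + psi a) / (1 - psi0 a)
      * (int01 (fun t => psi0 (t * a) + 1) / (1 - psi0 (eta1 psi0 psi a * a)))
      * a.
  by rewrite /eta2 /p; ring.
apply: lerD; first exact: newton_step_le.
exact: inverse_difference_residual_le.
Qed.

(** The error splits into a Newton step at [z] and the differences of inverses between [z] and [y]
    and between [x] and [y], all applied to [T z]; these are the three summands of [eta_step]. A
    free factor [e] serves both corrections. *)
Lemma correction_le x z a e : near_solution a x ->
  near_solution (eta1 psi0 psi a * a) (iter_y T x) ->
  near_solution (e * a) z ->
  `|correction T x z - xs| <= eta_step psi0 psi e a * a.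
Proof.
move=> xa ya ze; rewrite /correction.
set y := iter_y T x in ya *.
have -> : z - (2 *: opinv ('d T y) (T z) - opinv ('d T x) (T z)) - xs =
    (z - xs - opinv ('d T z) (T z))
    + (opinv ('d T z) (T z) - opinv ('d T y) (T z))
    + (opinv ('d T x) (T z) - opinv ('d T y) (T z)).
  rewrite [_ - xs - _ + _]addrA subrK scaler_nat mulr2n.
  rewrite [LHS]addrAC -[RHS]addrA; congr (_ + _).
  by rewrite opprB opprD addrCA.
apply: le_trans (ler_normD _ _) _.
rewrite eta_stepE /p -mulrA 2!mulrDl; apply: lerD; last first.
  by apply: le_trans (inverse_difference_residual_le _ _ _ _ _ _ xa ya ze) _.
apply: le_trans (ler_normD _ _) _; apply: lerD; first exact: newton_step_le.
exact: inverse_difference_residual_le.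
Qed.

(** Since [T] vanishes at both ends of the segment, [h] is the increment of
    [t h - B (T (xs + t h))], whose derivative is [B (A - T') h]. So the norm of [h] is at most
    itself times an integral below 1, which forces [h = 0]. *)
Lemma unique_solution (r : R) z : 0 <= r -> int01 (fun t => psi0 (t * r)) < 1 ->
  D z -> `|z - xs| <= r -> T z = 0 -> z = xs.
Proof.
move=> r0 int1 Dz zr Tz.
pose h := z - xs.
pose l (s : R) : X := s *: h.
pose F (t : R) := l t - B (T (xs + t *: h)).
have hF : h = F 1 - F 0.
  have xsh : xs + h = z by rewrite /h addrC subrK.
  by rewrite /F /l !scale0r addr0 T_xs linear0 !subr0 !scale1r xsh Tz linear0 subr0.
suff : `|h| <= int01 (fun t => psi0 (t * r)) * `|h|.
  move=> hle; apply/eqP; rewrite -subr_eq0 -normr_le0 -/h leNgt.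
  apply/negP => h0; move: hle.
  by rewrite -[leLHS]mul1r ler_pM2r// leNgt int1.
rewrite {1}hF.
apply: (norm_increment_le_gauge _ _ _ psi0 id) => //.
- exact: majorant_gauge.
- by move=> t; exact: cvg_id.
- by move=> t; rewrite in_itv /= => /andP[].
move=> t; rewrite in_itv /= => /andP[t0 t1].
have Dt : D (xs + t *: h) by exact: convex_segment.
have [dBT BTE] := segment_derive _ _ _ Dt.
have dl : is_diff t l l by exact: is_diff_scalel.
have dl1 : derivable l t 1 by apply: diff_derivable; exact: ex_diff.
split; first by apply: (derivableB (f := l)).
have -> : F = l - (fun s : R => B (T (xs + s *: h))) by [].
rewrite deriveB// BTE deriveE; last exact: ex_diff.
rewrite diff_val /l scale1r -{1}(BA h) -linearB -normrN -linearN opprB.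
apply: le_trans (center_le _ h Dt) _; apply: ler_wpM2r => //.
apply: majorant_le => //; rewrite addrC addKr normrZ ger0_norm//.
exact: ler_wpM2l.
Qed.

(** * Invariance of the ball and geometric convergence *)

Section Convergence.
Variables rho1 rho2 rho3 rho4 : R.
Hypotheses
  (rho1_def : smallest_zero psi0 (dom1 psi0) (H1 psi0 psi) rho1)
  (rho2_def : smallest_zero psi0 (dom2 psi0 psi) (H2 psi0 psi) rho2)
  (rho3_def : smallest_zero psi0 (dom3 psi0 psi) (H3 psi0 psi) rho3)
  (rho4_def : smallest_zero psi0 (dom4 psi0 psi) (H4 psi0 psi) rho4).

Let rho := Num.min (Num.min rho1 rho2) (Num.min rho3 rho4).

Hypothesis ball_D : ball xs rho `<=` D.

Let etas := radius_etas _ _ psi0_maj psi_maj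
  _ _ _ _ rho1_def rho2_def rho3_def rho4_def.

Lemma near_solution_lt b x : `|x - xs| <= b -> b < rho -> near_solution b x.
Proof.
move=> xb br; split=> //; last exact: (radius_lt_rho0 _ _ _ _ _ _ rho1_def _ br).
by apply: ball_D; rewrite -ball_normE /= distrC (le_lt_trans xb).
Qed.

(** A bootstrap: each estimate presupposes that the earlier points are near the solution, and
    [eta_i < 1] keeps the point just bounded in the ball for the next one. *)
Lemma iterates_near_solution x (a := `|x - xs|) : a < rho ->
  [/\ near_solution a x,
      near_solution (eta1 psi0 psi a * a) (iter_y T x),
      near_solution (eta2 psi0 psi a * a) (iter_z1 T x),
      near_solution (eta3 psi0 psi a * a) (iter_z2 T x)
    & near_solution (eta4 psi0 psi a * a) (iter_next T x)].
Proof.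
move=> ar; have a0 : 0 <= a by exact: normr_ge0.
have [] := etas _ a0 ar.
have lt_rho e : 0 <= e < 1 -> e * a < rho.
  by move=> /andP[e0 /ltW e1]; apply: le_lt_trans ar; rewrite ler_piMl.
move=> /lt_rho e1 /lt_rho e2 /lt_rho e3 /lt_rho e4.
have xa : near_solution a x by exact: near_solution_lt.
have ya := near_solution_lt _ _ (iter_y_le _ _ xa) e1.
have z1a := near_solution_lt _ _ (iter_z1_le _ _ xa ya) e2.
have z2a := near_solution_lt _ _ (correction_le _ _ _ _ xa ya z1a) e3.
have na := near_solution_lt _ _ (correction_le _ _ _ _ xa ya z2a) e4.
by split.
Qed.

Lemma iter_next_le x (a := `|x - xs|) : a < rho ->
  `|iter_next T x - xs| <= eta4 psi0 psi a * a.
Proof. by move=> /iterates_near_solution[_ _ _ _ []]. Qed.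

(** Distances never exceed the initial one, so monotonicity of [eta4] bounds every contraction
    factor by its value at [a]. *)
Lemma iter_seq_le x0 n (a := `|x0 - xs|) : a < rho ->
  `|iter_seq T x0 n - xs| <= eta4 psi0 psi a ^+ n * a /\
  `|iter_seq T x0 n - xs| <= a.
Proof.
move=> ar; have a0 : 0 <= a by exact: normr_ge0.
have [_ _ _ /andP[e0 /ltW e1]] := etas _ a0 ar.
have [_ mono _] := radius_gauge4 _ _ psi0_maj psi_maj
  _ _ _ _ rho1_def rho2_def rho3_def _ a0 ar.
suff le_n : `|iter_seq T x0 n - xs| <= eta4 psi0 psi a ^+ n * a.
  by split=> //; apply: le_trans le_n _; rewrite ler_piMl// exprn_ile1.
elim: n => [|n IH]; first by rewrite expr0 mul1r.
have na : `|iter_seq T x0 n - xs| <= a.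
  by apply: le_trans IH _; rewrite ler_piMl// exprn_ile1.
rewrite exprS -mulrA; apply: le_trans (iter_next_le _ (le_lt_trans na ar)) _.
apply: ler_pM => //; last by apply: mono; rewrite ?in_itv /= ?na ?a0 ?lexx ?normr_ge0.
have nr := le_lt_trans na ar.
by have [_ _ _ /andP[]] := etas _ (normr_ge0 _) nr.
Qed.

Lemma iter_seq_cvg x0 : `|x0 - xs| < rho -> iter_seq T x0 @ \oo --> xs.
Proof.
move=> ar; have [_ _ _ /andP[e0 e1]] := etas _ (normr_ge0 _) ar.
apply/cvgrPdist_le => e egt0.
have : `|eta4 psi0 psi `|x0 - xs| | < 1 by rewrite ger0_norm.
move=> /(cvg_geometric `|x0 - xs|)/cvgr0Pnorm_le/(_ _ egt0).
apply: filterS => n /=; rewrite mulrC ger0_norm ?mulr_ge0 ?exprn_ge0//.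
by apply: le_trans; rewrite distrC; have [] := iter_seq_le x0 n ar.
Qed.

End Convergence.

End Newton.

(** * Local convergence of the iteration and uniqueness of the solution *)

Theorem theorem2p1 (R : realType) (X Y : completeNormedModType R)
    (D : set X) (T : X -> Y) (xs : X) (psi0 psi : R -> R)
    (rho1 rho2 rho3 rho4 rho : R)
    (D_open : open D) (D_convex : convex_set D)
    (T_C1 : continuously_differentiable_on D T)
    (D_xs : D xs) (T_xs : T xs = 0)
    (dT_xs : has_bounded_inverse ('d T xs))
    (psi0_maj : majorant psi0) (psi_maj : majorant psi)
    (H1_lim : tends_to_positive (dom1 psi0) (H1 psi0 psi) (rho0 psi0))
    (H2_lim : tends_to_positive (dom2 psi0 psi) (H2 psi0 psi) (rho0 psi0))
    (H3_lim :
       tends_to_positive (dom3 psi0 psi) (H3 psi0 psi) (rho0bar psi0 psi))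
    (H4_lim :
       tends_to_positive (dom4 psi0 psi) (H4 psi0 psi) (rho0bar psi0 psi))
    (rho1_def : smallest_zero psi0 (dom1 psi0) (H1 psi0 psi) rho1)
    (rho2_def : smallest_zero psi0 (dom2 psi0 psi) (H2 psi0 psi) rho2)
    (rho3_def : smallest_zero psi0 (dom3 psi0 psi) (H3 psi0 psi) rho3)
    (rho4_def : smallest_zero psi0 (dom4 psi0 psi) (H4 psi0 psi) rho4)
    (rho_def : rho = Num.min (Num.min rho1 rho2) (Num.min rho3 rho4))
    (center_lip : forall x, D x ->
       (opnorm (opinv ('d T xs) \o ('d T x \- 'd T xs))%R
          <= (psi0 `|x - xs|%R)%:E)%E)
    (lip : forall x y,
       (D `&` eball xs (rho0 psi0)) x -> (D `&` eball xs (rho0 psi0)) y ->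
       (opnorm (opinv ('d T xs) \o ('d T x \- 'd T y))%R
          <= (psi `|x - y|%R)%:E)%E)
    (ball_D : ball xs rho `<=` D) :
  (forall x0 : X, ball xs rho x0 -> x0 != xs ->
     let x := iter_seq T x0 in
     let y n := iter_y T (x n) in
     let z1 n := iter_z1 T (x n) in
     let z2 n := iter_z2 T (x n) in
     [/\ (* the sequence is well defined *)
         forall n,
           [/\ D (x n), D (z1 n) & D (z2 n)] /\
           [/\ has_bounded_inverse ('d T (x n)), D (y n)
             & has_bounded_inverse ('d T (y n))],
         forall n, ball xs rho (x n),
         x @ \oo --> xs
       & forall n,
           let a := `|x n - xs| in
           [/\ `|y n - xs| <= eta1 psi0 psi a * a <= a,
               `|z1 n - xs| <= eta2 psi0 psi a * a <= a,
               `|z2 n - xs| <= eta3 psi0 psi a * a <= a,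
               `|x n.+1 - xs| <= eta4 psi0 psi a * a <= a
             & a < rho]])
  /\
  (forall varrho : R, rho <= varrho ->
     int01 (fun t => psi0 (t * varrho)) < 1 ->
     [set x | (D `&` closed_ball xs varrho) x /\ T x = 0] = [set xs]).
Proof.
subst rho.
have rho_gt0 := radius_gt0 _ _ _ _ _ _ rho1_def rho2_def rho3_def rho4_def.
split=> [x0|varrho rho_varrho int1]; last first.
  (* Positivity of the radius identifies [closed_ball], a closure, with the set of points at
     distance at most [varrho]. *)
  have varrho_gt0 : 0 < varrho by exact: lt_le_trans rho_varrho.
  rewrite closed_ballE//; apply/seteqP; split=> [z [[Dz zr] Tz]|z ->] /=.
    apply: (unique_solution D T xs psi0) int1 Dz _ Tz => //; first exact: ltW.
    by rewrite distrC.
  by split=> //; split=> //; rewrite /closed_ball_ /= subrr normr0 ltW.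
rewrite -ball_normE /= distrC => x0_rho _.
have nears := iterates_near_solution D T xs psi0 psi D_convex T_C1 D_xs T_xs
  dT_xs psi0_maj psi_maj center_lip lip _ _ _ _
  rho1_def rho2_def rho3_def rho4_def ball_D.
have seq_le n := iter_seq_le D T xs psi0 psi D_convex T_C1 D_xs T_xs
  dT_xs psi0_maj psi_maj center_lip lip _ _ _ _
  rho1_def rho2_def rho3_def rho4_def ball_D x0 n x0_rho.
have x_rho n := le_lt_trans (seq_le n).2 x0_rho.
have inv := near_solution_inverse D T xs psi0 dT_xs psi0_maj center_lip.
split=> [n|n||n].
- have [xa ya [Dz1 _ _] [Dz2 _ _] _] := nears _ (x_rho n).
  have [Dx _ _] := xa; have [Dy _ _] := ya.
  by split; split=> //; [exact: (inv _ _ xa).1|exact: (inv _ _ ya).1].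
- by rewrite distrC.
- exact: (iter_seq_cvg D T xs psi0 psi D_convex T_C1 D_xs T_xs
    dT_xs psi0_maj psi_maj center_lip lip _ _ _ _
    rho1_def rho2_def rho3_def rho4_def ball_D).
have [_ [_ ya _] [_ z1a _] [_ z2a _] [_ na _]] := nears _ (x_rho n).
have [/andP[_ e1] /andP[_ e2] /andP[_ e3] /andP[_ e4]] :=
  radius_etas _ _ psi0_maj psi_maj _ _ _ _ rho1_def rho2_def rho3_def rho4_def
    _ (normr_ge0 _) (x_rho n).
by split=> //; apply/andP; split=> //; rewrite ler_piMl// ltW.
Qed.
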